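(* Assume $\lim_{n\to\infty}X'X/n=Q$ exists and is positive definite. Then: (1) $\lim_{M\to\infty}\sup_{n\ge k}\sup_{\beta\in\mathbb{R}^k}\mathbb{P}_{n,\beta,\sigma}\big(\sqrt n\|\tilde\beta-\beta\|\ge M\big)=0$; consequently, for every $\varepsilon>0$ and every sequence of reals $c_n\ge0$ with $c_n=o(n^{1/2})$, $\lim_{n\to\infty}\sup_{\beta\in\mathbb{R}^k}\mathbb{P}_{n,\beta,\sigma}(c_n\|\tilde\beta-\beta\|\ge\varepsilon)=0$ (in particular, with $c_n=1$, $\tilde\beta$ is uniformly consistent). (2) The same two statements hold with $\tilde\beta-\beta$ replaced by $A_n\tilde\beta-A_n\beta$, for any non-stochastic $p_n\times k$ matrices $A_n$ whose largest eigenvalues $\lambda_{\max}(A_n'A_n)$ are bounded in $n$.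
   Context: Setup: for each sample size $n$, $Y=X\beta+u$, where $Y$ is $n\times1$, $X$ is a non-stochastic $n\times k$ matrix of full column rank $k$ (so $n\ge k$), $k>1$, and $u\sim N(0,\sigma^2I_n)$ with $0<\sigma^2<\infty$ known and fixed. $\mathbb{P}_{n,\beta,\sigma}$ denotes the distribution of $Y$. Partition $X=[X_1:X_2]$ and $\beta=(\beta_1',\beta_2')'$ commensurably, with $X_i$ having $k_i\ge1$ columns. $\hat\beta(R)=\big(((X_1'X_1)^{-1}X_1'Y)',0_{1\times k_2}\big)'$, $\hat\beta(U)=(X'X)^{-1}X'Y$. For $\alpha>0$, $\tilde\beta=\hat\lambda\hat\beta(R)+(1-\hat\lambda)\hat\beta(U)$ with $\hat\lambda=\big[1+\exp(-2\alpha k_2)\exp(\alpha\|X\hat\beta(R)-X\hat\beta(U)\|^2/\sigma^2)\big]^{-1}$. *)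

(* Defs.v *)
From HB Require Import structures.
From mathcomp Require Import all_boot all_order all_algebra.
From mathcomp Require Import all_classical all_reals all_analysis.
Set Implicit Arguments. Unset Strict Implicit. Unset Printing Implicit Defensive.
Import Order.TTheory GRing.Theory Num.Theory.
Import numFieldNormedType.Exports.
Local Open Scope classical_set_scope.
Local Open Scope ring_scope.

Section Defs.
Variable R : realType.

Definition enorm (m : nat) (v : 'cV[R]_m) : R := Num.sqrt (\sum_i v i 0 ^+ 2).

Definition ols (n m : nat) (Z : 'M[R]_(n, m)) (Y : 'cV[R]_n) : 'cV[R]_m :=
  invmx (Z^T *m Z) *m (Z^T *m Y).

Definition beta_R (k1 k2 n : nat) (X : 'M[R]_(n, k1 + k2)) (Y : 'cV[R]_n)
  : 'cV[R]_(k1 + k2) := col_mx (ols (lsubmx X) Y) 0.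

Definition beta_U (k1 k2 n : nat) (X : 'M[R]_(n, k1 + k2)) (Y : 'cV[R]_n)
  : 'cV[R]_(k1 + k2) := ols X Y.

Definition lambda_hat (sigma alpha : R) (k1 k2 n : nat)
  (X : 'M[R]_(n, k1 + k2)) (Y : 'cV[R]_n) : R :=
  (1 + expR (- (2 * alpha * k2%:R)) *
       expR (alpha * enorm (X *m beta_R X Y - X *m beta_U X Y) ^+ 2 / sigma ^+ 2))^-1.

Definition beta_tilde (sigma alpha : R) (k1 k2 n : nat)
  (X : 'M[R]_(n, k1 + k2)) (Y : 'cV[R]_n) : 'cV[R]_(k1 + k2) :=
  lambda_hat sigma alpha X Y *: beta_R X Y + (1 - lambda_hat sigma alpha X Y) *: beta_U X Y.

Definition posdef (m : nat) (Q : 'M[R]_m) : Prop :=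
  forall v : 'cV[R]_m, v != 0 -> 0 < (v^T *m Q *m v) 0 0.

Definition mutually_independent d (T : measurableType d) (P : probability T R)
  (e : nat -> T -> R) : Prop :=
  forall (I : seq nat) (B : nat -> set R), uniq I ->
    (forall i, measurable (B i)) ->
    P (\bigcap_(i in [set` I]) (e i @^-1` B i)) = (\prod_(i <- I) P (e i @^-1` B i))%E.

Definition noise d (T : measurableType d) (e : nat -> T -> R) (n : nat) (w : T)
  : 'cV[R]_n := \col_(i < n) e i w.

End Defs.

(* Main.v *)
(* The gain [lambda] decays exponentially in [||X bR - X bU||^2], so
   [lambda ||X bR - X bU||] is bounded by a constant that depends neither on n
   nor on beta.  Hence [X (bt - beta)] differs from [X (bU - beta)] = H u, with
   H the hat matrix, by a bounded vector.  Since E ||H u||^2 = s tr H = s k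
   with s = E u_1^2 finite, and since [X'X / n] is bounded below uniformly in n >= k (it is
   positive definite for each n and converges to the positive definite Q),
   Chebyshev's inequality bounds P (M <= sqrt n ||A_n (bt - beta)||) by K / M^2
   with K independent of n and beta.  Part (1) is the case A_n = I. *)
Require Import Defs.
From HB Require Import structures.
From mathcomp Require Import all_boot all_order all_algebra.
From mathcomp Require Import all_classical all_reals all_analysis.
From mathcomp Require Import measurable_realfun ring lra.
Set Implicit Arguments. Unset Strict Implicit. Unset Printing Implicit Defensive.
Import Order.TTheory GRing.Theory Num.Theory.
Import numFieldNormedType.Exports.
Local Open Scope classical_set_scope.
Local Open Scope ring_scope.

(** * Euclidean norm and quadratic forms *)

Definition qform (R : nzRingType) (k : nat) (S : 'M[R]_k) (v : 'cV[R]_k) : R :=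
  (v^T *m S *m v) 0 0.

Lemma enorm_sum (R : realType) (m : nat) (v : 'cV[R]_m) :
  enorm v ^+ 2 = \sum_i v i 0 ^+ 2.
Proof. by rewrite sqr_sqrtr// sumr_ge0// => i _; exact: sqr_ge0. Qed.

Lemma enorm_sqr (R : realType) (m : nat) (v : 'cV[R]_m) :
  enorm v ^+ 2 = (v^T *m v) 0 0.
Proof.
by rewrite enorm_sum mxE; apply: eq_bigr => i _; rewrite mxE expr2.
Qed.

Lemma enorm_ge0 (R : realType) (m : nat) (v : 'cV[R]_m) : 0 <= enorm v.
Proof. exact: sqrtr_ge0. Qed.

Lemma enorm_eq0 (R : realType) (m : nat) (v : 'cV[R]_m) : (enorm v == 0) = (v == 0).
Proof.
apply/idP/eqP => [|->]; last first.
  by rewrite /enorm big1 ?sqrtr0// => i _; rewrite mxE expr0n.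
rewrite sqrtr_eq0 => h; apply/matrixP => i j; rewrite (ord1 j) [RHS]mxE.
have /eqP : \sum_i v i 0 ^+ 2 = 0.
  by apply/eqP; rewrite eq_le h sumr_ge0// => l _; exact: sqr_ge0.
rewrite psumr_eq0; last by move=> l _; exact: sqr_ge0.
by move=> /allP/(_ i); rewrite mem_index_enum => /(_ erefl)/=; rewrite sqrf_eq0 => /eqP.
Qed.

Lemma enorm_gt0 (R : realType) (m : nat) (v : 'cV[R]_m) : (0 < enorm v) = (v != 0).
Proof. by rewrite lt0r enorm_ge0 andbT enorm_eq0. Qed.

Lemma enormZ_sqr (R : realType) (m : nat) (a : R) (v : 'cV[R]_m) :
  enorm (a *: v) ^+ 2 = a ^+ 2 * enorm v ^+ 2.
Proof.
by rewrite !enorm_sqr [(a *: v)^T]linearZ/= -scalemxAl -scalemxAr scalerA mxE expr2.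
Qed.

Lemma enormD_sqr_le (R : realType) (m : nat) (v w : 'cV[R]_m) :
  enorm (v + w) ^+ 2 <= 2 * enorm v ^+ 2 + 2 * enorm w ^+ 2.
Proof.
rewrite !enorm_sum !mulr_sumr -big_split/=; apply: ler_sum => i _.
by rewrite mxE -subr_ge0 [leRHS](_ : _ = (v i 0 - w i 0) ^+ 2) ?sqr_ge0//; ring.
Qed.

Lemma qform_mulmx (R : realType) (m k : nat) (A : 'M[R]_(m, k)) (v : 'cV[R]_k) :
  qform (A^T *m A) v = enorm (A *m v) ^+ 2.
Proof. by rewrite enorm_sqr /qform trmx_mul !mulmxA. Qed.

Lemma qformZ (R : comNzRingType) (k : nat) (S : 'M[R]_k) (a : R) (v : 'cV[R]_k) :
  qform (a *: S) v = a * qform S v.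
Proof. by rewrite /qform -scalemxAr -scalemxAl mxE. Qed.

Lemma qform_scale (R : comNzRingType) (k : nat) (S : 'M[R]_k) (a : R) (v : 'cV[R]_k) :
  qform S (a *: v) = a ^+ 2 * qform S v.
Proof.
by rewrite /qform [(a *: v)^T]linearZ/= -!scalemxAl -scalemxAr scalerA mxE expr2.
Qed.

Lemma qform_sum (R : comNzRingType) (k : nat) (S : 'M[R]_k) (v : 'cV[R]_k) :
  qform S v = \sum_i \sum_j S i j * (v i 0 * v j 0).
Proof.
rewrite /qform -mulmxA mxE; apply: eq_bigr => i _.
rewrite !mxE mulr_sumr; apply: eq_bigr => j _; ring.
Qed.

Lemma qformB (R : comNzRingType) (k : nat) (S S' : 'M[R]_k) (v : 'cV[R]_k) :
  qform (S - S') v = qform S v - qform S' v.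
Proof. by rewrite /qform mulmxBr mulmxBl !mxE. Qed.

Lemma qform1 (R : realType) (k : nat) (v : 'cV[R]_k) : qform 1%:M v = enorm v ^+ 2.
Proof. by rewrite /qform mulmx1 enorm_sqr. Qed.

(** * Extrema of quadratic forms on the unit sphere *)

(** The unit sphere is compact, and nonempty because [0 < k], so the continuous form attains its
    maximum there; homogeneity of degree two extends the bound to all vectors. *)
Lemma qform_max (R : realType) (k : nat) (S : 'M[R]_k) : (0 < k)%N ->
  exists2 v : 'cV[R]_k, enorm v = 1 &
    forall w, qform S w <= qform S v * enorm w ^+ 2.
Proof.
move=> k0; pose i0 := Ordinal k0.
(* [EVT_max_rV] speaks of row vectors, so the form is restated on them as an explicit polynomial,
   whose continuity is checked term by term. *)
pose g (M : 'M[R]_k) (r : 'rV[R]_k) := \sum_i \sum_j M i j * (r 0 i * r 0 j).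
have gE M r : g M r = qform M r^T.
  by rewrite qform_sum; apply: eq_bigr => i _; apply: eq_bigr => j _; rewrite !mxE.
have cg M : continuous (g M).
  move=> r; apply: cvg_big => [|| i _]; [exact: add_continuous|exact: nbhs_filter|].
  apply: cvg_big => [|| j _]; [exact: add_continuous|exact: nbhs_filter|].
  apply: (@cvgM _ _ (nbhs r) _ (fun=> M i j)); first exact: cvg_cst.
  by apply: (@cvgM _ _ (nbhs r) _ (fun r => r 0 i) (fun r => r 0 j)); exact: coord_continuous.
pose A := [set r : 'rV[R]_k | g 1%:M r = 1].
have AE r : A r -> enorm r^T = 1.
  rewrite /A/= gE qform1 => /eqP; rewrite sqrf_eq1 => /orP[/eqP//|/eqP h].
  by have := enorm_ge0 r^T; rewrite h ler0N1.
have A0 : A !=set0.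
  exists (delta_mx 0 i0); rewrite /A/= gE qform1 enorm_sqr trmxK trmx_delta.
  by rewrite mul_delta_mx mxE !eqxx.
have cA : compact A.
  apply: bounded_closed_compact.
    exists 1; split => // M M1 r /AE r1.
    apply: le_trans (ltW M1); rewrite [leLHS]/Num.norm/= mx_normrE.
    apply: bigmax_le => //= -[i j] _ /=; rewrite (ord1 i).
    rewrite -(ler_pXn2r (_ : 0 < 2)%N) ?nnegrE// expr1n real_normK ?num_real//.
    rewrite -[leRHS](expr1n _ 2) -r1 enorm_sum.
    rewrite (bigD1 j)//= mxE lerDl sumr_ge0// => l _; exact: sqr_ge0.
  rewrite /A (_ : [set r | _] = g 1%:M @^-1` [set 1])//.
  by move/continuous_closedP : (cg 1%:M); apply; exact: closed_eq.
have [r rA rmax] := EVT_max_rV A0 cA (continuous_subspaceT (cg S)).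
move: rA; rewrite inE => rA.
exists r^T => [|w]; first exact: AE.
have [->|w0] := eqVneq w 0.
  by rewrite -(scale0r 0) qform_scale enormZ_sqr expr0n !mul0r mulr0.
have ew : 0 < enorm w by rewrite enorm_gt0.
have : g S ((enorm w)^-1 *: w)^T <= g S r.
  apply: rmax; rewrite inE /A/= gE trmxK qform1 enormZ_sqr.
  by rewrite exprVn mulVf// expf_neq0// gt_eqF.
by rewrite !gE trmxK qform_scale exprVn ler_pdivrMl ?exprn_gt0// mulrC.
Qed.

Lemma qform_min (R : realType) (k : nat) (S : 'M[R]_k) : (0 < k)%N ->
  exists2 v : 'cV[R]_k, enorm v = 1 &
    forall w, qform S v * enorm w ^+ 2 <= qform S w.
Proof.
move=> k0; have [v v1 vmax] := qform_max (- S) k0; exists v => // w.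
by have := vmax w; rewrite -scaleN1r !qformZ !mulN1r mulNr lerN2.
Qed.

(** The constant is the minimum of the form on the unit sphere, positive because it is attained at a
    nonzero vector. *)
Lemma posdef_coercive (R : realType) (k : nat) (S : 'M[R]_k) : (0 < k)%N ->
  posdef S -> exists2 c, 0 < c & forall w, c * enorm w ^+ 2 <= qform S w.
Proof.
move=> k0 pS; have [v v1 vmin] := qform_min S k0; exists (qform S v) => //.
by apply: pS; rewrite -enorm_gt0 v1.
Qed.

Lemma posdef_unitmx (R : realType) (k : nat) (S : 'M[R]_k) :
  posdef S -> S \in unitmx.
Proof.
move=> pS; rewrite -unitmx_tr -row_free_unit -kermx_eq0.
apply/rowV0P => r /sub_kermxP rS; apply/eqP; apply: contraT => r0.
have := pS r^T; rewrite trmx_eq0 => /(_ r0).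
by rewrite -mulmxA -[S]trmxK -trmx_mul rS trmx0 mulmx0 mxE ltxx.
Qed.

Lemma posdef_gram (R : realType) (n k : nat) (X : 'M[R]_(n, k)) :
  \rank X = k -> posdef (X^T *m X).
Proof.
move=> rX v v0; rewrite -/(qform _ _) qform_mulmx exprn_gt0// enorm_gt0.
apply: contraNneq v0 => Xv.
have : row_free X^T by rewrite /row_free mxrank_tr rX.
rewrite -kermx_eq0 => /eqP kX; rewrite -trmx_eq0 -submx0 -kX.
by apply/sub_kermxP; rewrite -trmx_mul Xv trmx0.
Qed.

(* A null vector of a positive semidefinite form minimises it, so the first
   variation vanishes there. *)
Lemma psd_qform_eq0 (R : realType) (k : nat) (S : 'M[R]_k) (v : 'cV[R]_k) :
  S^T = S -> (forall w, 0 <= qform S w) -> qform S v = 0 -> S *m v = 0.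
Proof.
move=> symS S0 Sv0; apply/eqP; rewrite -enorm_eq0; apply/negPn/negP => Sv.
pose w := S *m v; pose a := enorm w ^+ 2; pose b := qform S w.
have a0 : 0 < a by rewrite exprn_gt0// enorm_gt0 -enorm_eq0.
have b0 : 0 <= b by exact: S0.
(* A step against the gradient direction [w]. The denominator is [b + 1] rather than [b] because [b]
   may vanish; the form then takes the negative value [- a^2 (b + 2) / (b + 1)^2], a
   contradiction. *)
pose t := - a / (b + 1).
have : 0 <= qform S (v + t *: w) by exact: S0.
have -> : qform S (v + t *: w) = 2 * t * a + t ^+ 2 * b.
  rewrite /qform [(_ + _)^T]linearD/= !mulmxDl !mulmxDr.
  have wE : v^T *m S = w^T by rewrite trmx_mul symS.
  rewrite ![(_ *: _)^T]linearZ/= -!scalemxAl -!scalemxAr -(mulmxA w^T S v) -/w !wE.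
  move: Sv0; rewrite /qform wE => Sv0.
  have D (M N : 'M[R]_1) : (M + N) 0 0 = M 0 0 + N 0 0 by rewrite mxE.
  have Z c (M : 'M[R]_1) : (c *: M) 0 0 = c * M 0 0 by rewrite mxE.
  by rewrite /a /b enorm_sqr /qform !(D, Z) Sv0; ring.
rewrite /t leNgt => /negP; apply.
rewrite (_ : _ + _ = - (a ^+ 2 * (b + 2) / (b + 1) ^+ 2)); last first.
  by field; apply: lt0r_neq0; lra.
have [b1 b2] : 0 < b + 1 /\ 0 < b + 2 by split; lra.
by rewrite oppr_lt0 divr_gt0 ?mulr_gt0 ?exprn_gt0// enorm_gt0 -enorm_eq0.
Qed.

(** If [mu] is the maximum of the form of [A^T A] on the sphere, attained at [v], then [mu - A^T A]
    is positive semidefinite and its form vanishes at [v]. Hence [v] is an eigenvector for [mu], so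
    [mu <= B]. *)
Lemma enorm_mulmx_eigenvalue_le (R : realType) (m k : nat) (A : 'M[R]_(m, k)) (B : R) :
  (forall a, eigenvalue (A^T *m A) a -> a <= B) ->
  forall w, enorm (A *m w) ^+ 2 <= B * enorm w ^+ 2.
Proof.
(* With [k = 0] there are no eigenvalues and [B] is arbitrary, but both norms are zero. *)
case: k A => [|k] A hB w.
  have e0 n : enorm (0 : 'cV[R]_n) = 0 by apply/eqP; rewrite enorm_eq0.
  by rewrite (flatmx0 w) mulmx0 !e0 expr0n mulr0.
have [v v1 vmax] := qform_max (A^T *m A) (ltn0Sn k).
set mu := qform _ v in vmax.
have v0 : v != 0 by rewrite -enorm_gt0 v1.
have symAA : (A^T *m A)^T = A^T *m A by rewrite trmx_mul trmxK.
have /eqP : (mu%:M - A^T *m A) *m v = 0.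
  apply: psd_qform_eq0 => [|u|].
  - by rewrite linearB/= symAA tr_scalar_mx.
  - by rewrite qformB -scalemx1 qformZ qform1 subr_ge0.
  - by rewrite qformB -scalemx1 qformZ qform1 v1 expr1n mulr1 subrr.
rewrite mulmxBl mul_scalar_mx subr_eq0 => /eqP Ev.
rewrite -qform_mulmx (le_trans (vmax w))// ler_wpM2r ?sqr_ge0// hB//.
(* [eigenvalue] refers to row eigenvectors; symmetry of [A^T A] allows the transpose. *)
apply/eigenvalueP; exists v^T; last by rewrite trmx_eq0.
by rewrite -[in LHS]symAA -trmx_mul -Ev linearZ.
Qed.

(** * Coercivity of the Gram matrices, uniform in the sample size *)

Lemma ler_mx_norm_entry (R : realDomainType) (m n : nat) (M : 'M[R]_(m, n)) i j :
  `|M i j| <= mx_norm M.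
Proof. by rewrite mx_normrE; exact: (le_bigmax _ (fun ij => `|M ij.1 ij.2|) (i, j)). Qed.

(** Each [|w_i w_j|] is at most [(w_i^2 + w_j^2) / 2], and summing these over all pairs gives
    [k ||w||^2]. Entrywise convergence of matrices thus controls their forms. *)
Lemma qform_norm_le (R : realType) (k : nat) (M : 'M[R]_k) (w : 'cV[R]_k) :
  `|qform M w| <= k%:R * mx_norm M * enorm w ^+ 2.
Proof.
rewrite qform_sum (le_trans (ler_norm_sum _ _ _))//.
have -> : k%:R * mx_norm M * enorm w ^+ 2 =
    \sum_i \sum_j mx_norm M * ((w i 0 ^+ 2 + w j 0 ^+ 2) / 2).
  under eq_bigr do rewrite -mulr_sumr -mulr_suml big_split/= -enorm_sum sumr_const card_ord.
  rewrite -mulr_sumr -mulr_suml big_split/= sumr_const card_ord sumrMnl -enorm_sum.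
  by rewrite -mulr_natl; field.
apply: ler_sum => i _; rewrite (le_trans (ler_norm_sum _ _ _))//.
apply: ler_sum => j _; rewrite normrM ler_pM// ?ler_mx_norm_entry// normrM.
have := sqr_ge0 (`|w i 0| - `|w j 0|).
rewrite -[w i 0 ^+ 2]real_normK ?num_real// -[w j 0 ^+ 2]real_normK ?num_real//.
nra.
Qed.

(** Only finitely many sample sizes are involved, each with a positive definite Gram matrix, so a
    minimum of constants works. *)
Lemma gram_coercive_lt (R : realType) (k : nat) (X : forall n : nat, 'M[R]_(n, k)) (N : nat) :
  (0 < k)%N -> (forall n, (k <= n)%N -> \rank (X n) = k) ->
  exists2 c, 0 < c & forall n w, (k <= n < N)%N ->
    c * (n%:R * enorm w ^+ 2) <= enorm (X n *m w) ^+ 2.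
Proof.
move=> k0 rX; elim: N => [|N [c c0 hc]]; first by exists 1 => // n w /andP[].
(* If [N < k], no [n] satisfies [k <= n <= N]; otherwise [n = N] is the one new case. *)
have [kN|Nk] := leqP k N; last first.
  by exists c => // n w /andP[kn nN]; have := leq_trans (leq_trans Nk kn) nN; rewrite ltnn.
have [c' c'0 hc'] := posdef_coercive k0 (posdef_gram (rX N kN)).
have N0 : 0 < N%:R :> R by rewrite ltr0n (leq_trans k0).
exists (Num.min c (c' / N%:R)) => [|n w]; first by rewrite lt_min c0 divr_gt0.
rewrite ltnS => /andP[kn]; rewrite leq_eqVlt => /predU1P[->|nN].
  rewrite -qform_mulmx (le_trans _ (hc' w))// mulrA ler_wpM2r ?sqr_ge0//.
  by rewrite -ler_pdivlMr// ge_min lexx orbT.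
rewrite (le_trans _ (hc n w _)) ?kn// ler_wpM2r ?mulr_ge0 ?enorm_ge0//.
by rewrite ge_min lexx.
Qed.

(** Past some [N] the scaled Gram matrix is so close to [Q] that its form keeps half of the
    coercivity constant of [Q]; the sizes below [N] fall under [gram_coercive_lt]. *)
Lemma gram_coercive (R : realType) (k : nat) (X : forall n : nat, 'M[R]_(n, k)) (Q : 'M[R]_k) :
  (0 < k)%N -> (forall n, (k <= n)%N -> \rank (X n) = k) ->
  (fun n => (n%:R)^-1 *: ((X n)^T *m X n)) @ \oo --> Q -> posdef Q ->
  exists2 c, 0 < c & forall n w, (k <= n)%N ->
    c * (n%:R * enorm w ^+ 2) <= enorm (X n *m w) ^+ 2.
Proof.
move=> k0 rX XQ pQ; have [c c0 hc] := posdef_coercive k0 pQ.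
have kR : 0 < k%:R :> R by rewrite ltr0n.
(* The factor [k] of [qform_norm_le] turns this radius into a loss of at most [c / 2]. *)
have d0 : 0 < c / (2 * k%:R) by rewrite divr_gt0 ?mulr_gt0.
have /cvgrPdist_lt/(_ _ d0)[N _ hN] := XQ.
have [c' c'0 hc'] := gram_coercive_lt N k0 rX.
exists (Num.min c' (c / 2)) => [|n w kn]; first by rewrite lt_min c'0 divr_gt0.
have n0 : 0 < n%:R :> R by rewrite ltr0n (leq_trans k0).
have [nN|Nn] := ltnP n N.
  rewrite (le_trans _ (hc' n w _)) ?kn// ler_wpM2r ?mulr_ge0 ?enorm_ge0//.
  by rewrite ge_min lexx.
have {}hN : mx_norm (Q - n%:R^-1 *: ((X n)^T *m X n)) < c / (2 * k%:R) := hN n Nn.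
rewrite (le_trans (_ : _ <= c / 2 * (n%:R * enorm w ^+ 2)))//.
  by rewrite ler_wpM2r ?mulr_ge0 ?enorm_ge0// ge_min lexx orbT.
rewrite mulrCA -ler_pdivlMl// -qform_mulmx -qformZ.
have := qform_norm_le (Q - n%:R^-1 *: ((X n)^T *m X n)) w.
move: (hc w); rewrite qformB; move/ltW: hN.
move: (mx_norm _) (qform _ _) (qform _ _) => m q q' hm hq /(le_trans (ler_norm _)) hq'.
have : k%:R * m * enorm w ^+ 2 <= c / 2 * enorm w ^+ 2.
  rewrite ler_wpM2r ?sqr_ge0// (le_trans (ler_wpM2l (ltW kR) hm))//.
  by rewrite le_eqVlt; apply/orP; left; apply/eqP; field; rewrite gt_eqF.
move: hq'; lra.
Qed.

(** * Least squares and the averaged estimator *)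

Definition hat_mx (R : realType) (n k : nat) (X : 'M[R]_(n, k)) : 'M[R]_n :=
  X *m invmx (X^T *m X) *m X^T.

(** By cyclicity of the trace. This is what keeps the expected squared norm of the projected noise
    independent of [n]. *)
Lemma trace_hat_mx (R : realType) (n k : nat) (X : 'M[R]_(n, k)) :
  X^T *m X \in unitmx -> \tr (hat_mx X) = k%:R.
Proof. by move=> uX; rewrite /hat_mx mxtrace_mulC mulmxA mulmxV// mxtrace1. Qed.

(** The hat matrix is symmetric and idempotent. *)
Lemma enorm_hat_mx (R : realType) (n k : nat) (X : 'M[R]_(n, k)) (u : 'cV[R]_n) :
  X^T *m X \in unitmx -> enorm (X *m ols X u) ^+ 2 = qform (hat_mx X) u.
Proof.
move=> uX; rewrite /ols !mulmxA -qform_mulmx; congr (qform _ u).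
rewrite /hat_mx !trmx_mul trmxK trmx_inv trmx_mul trmxK.
by rewrite !mulmxA -(mulmxA _ X^T X) mulmxKV.
Qed.

Lemma ols_linear_model (R : realType) (n k : nat) (X : 'M[R]_(n, k)) b (u : 'cV[R]_n) :
  X^T *m X \in unitmx -> ols X (X *m b + u) = b + ols X u.
Proof. by move=> uX; rewrite /ols !mulmxDr mulmxA mulKmx. Qed.

(* With [tau = ||X bR - X bU||^2] and [a = exp (- 2 alpha k2)], one has
   [lambda tau <= tau / (a exp (alpha tau / sigma^2)) <= sigma^2 / (a alpha)]
   because [x <= exp x]. *)
Lemma lambda_hat_sqr_le (R : realType) (sigma alpha : R) (k1 k2 n : nat)
    (X : 'M[R]_(n, k1 + k2)) (Y : 'cV[R]_n) : 0 < sigma -> 0 < alpha ->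
  lambda_hat sigma alpha X Y ^+ 2 * enorm (X *m beta_R X Y - X *m beta_U X Y) ^+ 2
  <= sigma ^+ 2 / alpha * expR (2 * alpha * k2%:R).
Proof.
move=> s0 a0; rewrite /lambda_hat; set tau := enorm _ ^+ 2.
have tau0 : 0 <= tau by exact: sqr_ge0.
rewrite -[X in _ <= _ * expR X]opprK [in leRHS]expRN.
set a := expR (- _); set z := expR _.
have apos : 0 < a by exact: expR_gt0.
have zpos : 0 < z by exact: expR_gt0.
have hz : alpha * tau / sigma ^+ 2 <= z.
  by rewrite (le_trans _ (expR_ge1Dx _))// lerDr.
have az0 : 0 < a * z by rewrite mulr_gt0.
have l1 : (1 + a * z)^-1 <= 1 by rewrite invf_le1 ?lerDl ?ltW// addr_gt0.
have l0 : 0 <= (1 + a * z)^-1 by rewrite invr_ge0 addr_ge0// ltW.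
(* Since the weight lies in [0, 1], its square is at most itself. *)
rewrite (le_trans (_ : _ <= (1 + a * z)^-1 * tau))//.
  by rewrite ler_wpM2r// expr2 ler_piMl.
rewrite (le_trans (_ : _ <= (a * z)^-1 * tau))//.
  by rewrite ler_wpM2r// lef_pV2 ?posrE ?addr_gt0// lerDr.
rewrite ler_pdivrMl// mulrC.
rewrite (_ : _ * (a * z) = sigma ^+ 2 / alpha * z); last by field; rewrite !gt_eqF.
by rewrite mulrAC ler_pdivlMr// mulrC [leRHS]mulrC -ler_pdivrMr ?exprn_gt0//.
Qed.

(** The estimator is [bU + lambda (bR - bU)], and [bU - b = ols X u] does not involve [b]. The
    parameter enters only through the weighted difference, which [lambda_hat_sqr_le] bounds without
    reference to it. *)
Lemma enorm_beta_tilde_le (R : realType) (sigma alpha : R) (k1 k2 n : nat)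
    (X : 'M[R]_(n, k1 + k2)) b (u : 'cV[R]_n) : 0 < sigma -> 0 < alpha ->
  X^T *m X \in unitmx ->
  enorm (X *m (beta_tilde sigma alpha X (X *m b + u) - b)) ^+ 2
  <= 2 * qform (hat_mx X) u + 2 * (sigma ^+ 2 / alpha * expR (2 * alpha * k2%:R)).
Proof.
move=> s0 a0 uX; set Y := X *m b + u; set l := lambda_hat sigma alpha X Y.
have -> : X *m (beta_tilde sigma alpha X Y - b) =
    X *m ols X u + l *: (X *m beta_R X Y - X *m beta_U X Y).
  rewrite /beta_tilde -/l /beta_U ols_linear_model// -mulmxBr scalemxAr -mulmxDr.
  congr (X *m _); rewrite !scalerBr scalerBl scale1r !scalerDr.
  by rewrite opprD; apply/matrixP => i j; rewrite !mxE; ring.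
rewrite (le_trans (enormD_sqr_le _ _))// enorm_hat_mx// enormZ_sqr.
by rewrite lerD2l ler_wpM2l// lambda_hat_sqr_le.
Qed.

(** * Normal moments and white noise *)

Section normal_moments.
Context {R : realType}.
Local Notation mu := (@lebesgue_measure R).
Local Open Scope ereal_scope.

(** The Radon-Nikodym derivative of the normal law and the normal density have the same integral
    over every measurable set, hence agree almost everywhere. *)
Lemma ge0_integral_normal_prob (m s : R) (f : R -> \bar R) : (s != 0)%R ->
  (forall x, 0 <= f x) -> measurable_fun setT f ->
  \int[normal_prob m s]_x f x = \int[mu]_x (f x * (normal_pdf m s x)%:E).
Proof.
move=> s0 f0 mf; have dom := normal_prob_dominates m s.
rewrite -(Radon_Nikodym_SigmaFinite.change_of_variables dom)//.
have rnint := Radon_Nikodym_SigmaFinite.f_integrable dom.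
have mpdf : measurable_fun setT (fun x : R => (normal_pdf m s x)%:E).
  by apply/measurable_EFinP; exact: measurable_normal_pdf.
apply: ae_eq_integral => //.
- by apply: emeasurable_funM => //; exact: measurable_int rnint.
- exact: emeasurable_funM.
- apply: ae_eqe_mul2l; apply: integral_ae_eq => // E _ mE.
  by rewrite -Radon_Nikodym_SigmaFinite.f_integral.
Qed.

(** The integrand is dominated by a multiple of the normal density with variance [2 s^2]. With
    [y = x^2 / (4 s^2)] the two exponentials are [exp (- 2 y)] and [exp (- y)], and
    [y exp (- y) <= 1] absorbs the factor [x^2]. *)
Lemma normal_second_moment_lty (s : R) : (s != 0)%R ->
  \int[mu]_x ((x ^+ 2)%:E * (normal_pdf 0 s x)%:E) < +oo.
Proof.
move=> s0; pose s' : R := (s * Num.sqrt 2)%R.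
have s'0 : (s' != 0)%R by rewrite mulf_neq0// gt_eqF// sqrtr_gt0.
have s'2 : (s' ^+ 2 = 2 * s ^+ 2)%R.
  by rewrite exprMn sqr_sqrtr// mulrC.
pose C : R := (4 * s ^+ 2 * (normal_peak s / normal_peak s'))%R.
have C0 : (0 <= C)%R.
  by rewrite mulr_ge0 ?divr_ge0 ?normal_peak_ge0// mulr_ge0 ?sqr_ge0.
apply: (@le_lt_trans _ _ (\int[mu]_x (C%:E * (normal_pdf 0 s' x)%:E))).
  apply: ge0_le_integral => //.
  - by move=> x _; rewrite -EFinM lee_fin mulr_ge0 ?sqr_ge0 ?normal_pdf_ge0.
  - apply: emeasurable_funM; first by apply/measurable_EFinP; exact: measurable_funX.
    by apply/measurable_EFinP; exact: measurable_normal_pdf.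
  - apply: emeasurable_funM => //.
    by apply/measurable_EFinP; exact: measurable_normal_pdf.
  - move=> x _; rewrite -!EFinM lee_fin !normal_pdfE// /normal_fun !subr0 s'2.
    set y : R := (x ^+ 2 / (4 * s ^+ 2))%R.
    have -> : (- x ^+ 2 / (s ^+ 2 *+ 2) = - y + - y)%R by rewrite /y; field.
    have -> : (- x ^+ 2 / ((2 * s ^+ 2) *+ 2) = - y)%R by rewrite /y; field.
    rewrite /C expRD.
    have yexp : (y * expR (- y) <= 1)%R.
      rewrite expRN ler_pdivrMr ?expR_gt0// mul1r (le_trans _ (expR_ge1Dx _))//.
      by rewrite lerDr.
    have pk' : (normal_peak s' != 0)%R by rewrite gt_eqF// normal_peak_gt0.
    rewrite [leLHS](_ : _ = 4 * s ^+ 2 * normal_peak s * expR (- y) * (y * expR (- y)))%R; last first.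
      by rewrite /y; field.
    rewrite [leRHS](_ : _ = 4 * s ^+ 2 * normal_peak s * expR (- y) * 1)%R; last by field.
    rewrite ler_wpM2l// mulr_ge0 ?expR_ge0// mulr_ge0 ?normal_peak_ge0//.
    by rewrite mulr_ge0 ?sqr_ge0.
rewrite integralZl//; last exact: integrable_normal_pdf.
by rewrite integral_normal_pdf mule1 ltry.
Qed.

(** The density is even, so the reflection [x -> - x] exchanges the two integrals, each of which is
    carried by a half-line. *)
Lemma normal_posneg_moment (s : R) : (s != 0)%R ->
  \int[mu]_x ((Num.max x 0)%:E * (normal_pdf 0 s x)%:E) =
  \int[mu]_x ((Num.max (- x) 0)%:E * (normal_pdf 0 s x)%:E).
Proof.
move=> s0; pose G (x : R) : R := (Num.max (- x) 0 * normal_pdf 0 s x)%R.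
have Gopp x : (G (- x) = Num.max x 0 * normal_pdf 0 s x)%R.
  by rewrite /G opprK !normal_pdfE// /normal_fun !subr0 sqrrN.
have cG : continuous G.
  move=> x; apply: cvgM; last exact: continuous_normal_pdf.
  apply: (@continuous_max _ _ (-%R) (cst 0)%R); last exact: cvg_cst.
  exact: opp_continuous.
have G0 x : (0 <= G x)%R by rewrite mulr_ge0 ?normal_pdf_ge0// le_max lexx orbT.
transitivity (\int[mu]_(x in `[0%R, +oo[) ((G \o -%R) x)%:E).
  rewrite [RHS]integral_mkcond; apply: eq_integral => x _ /=.
  rewrite patchE mem_setE in_itv/= andbT -EFinM -Gopp; case: ifPn => // x0.
  by rewrite Gopp max_r ?mul0r// ltW// ltNge.
rewrite -ge0_integration_by_substitutionNy//; last exact: continuous_subspaceT.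
rewrite oppr0 integral_mkcond; apply: eq_integral => x _ /=.
rewrite patchE mem_setE in_itv/= -EFinM; case: ifPn => // x0.
by rewrite max_r ?mul0r// oppr_le0 ltW// ltNge.
Qed.

End normal_moments.

Section normal_variables.
Context {R : realType} {d : measure_display} {T : measurableType d}.
Variables (P : probability T R).
Local Open Scope ereal_scope.

Lemma ge0_integral_normal_law (s : R) (X : {RV P >-> R}) (f : R -> R) : (s != 0)%R ->
  (forall B : set R, measurable B -> P (X @^-1` B) = normal_prob 0 s B) ->
  (forall x, (0 <= f x)%R) -> measurable_fun setT f ->
  \int[P]_w (f (X w))%:E =
  \int[lebesgue_measure]_x ((f x)%:E * (normal_pdf 0 s x)%:E).
Proof.
move=> s0 lawX f0 mf.
have mX : measurable_fun setT (X : T -> measurableTypeR R).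
  by move=> _ B mB; exact: (measurable_funPT X measurableT B mB).
(* The same function, retyped so that its distribution can be compared with [normal_prob]. *)
pose X' : {mfun T >-> measurableTypeR R} :=
  HB.pack (X : T -> measurableTypeR R) (isMeasurableFun.Build _ _ _ _ _ mX).
have mEf : measurable_fun [set: measurableTypeR R] (fun x => (f x)%:E).
  exact/measurable_EFinP.
rewrite -ge0_integral_normal_prob//.
transitivity (\int[distribution P X']_x (f x)%:E).
  by rewrite ge0_integral_pushforward// => x _; rewrite lee_fin.
by apply: eq_measure_integral => A mA _; exact: lawX.
Qed.

Lemma normal_sqr_integrable (s : R) (X : {RV P >-> R}) : (s != 0)%R ->
  (forall B : set R, measurable B -> P (X @^-1` B) = normal_prob 0 s B) ->
  P.-integrable setT (fun w => (X w ^+ 2)%:E).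
Proof.
move=> s0 lawX; apply/integrableP; split.
  by apply/measurable_EFinP; exact: measurable_funX.
under eq_integral do rewrite gee0_abs ?lee_fin ?sqr_ge0//.
rewrite (ge0_integral_normal_law s0 lawX (f := fun x => (x ^+ 2)%R)).
- exact: normal_second_moment_lty.
- by move=> x; exact: sqr_ge0.
- exact: measurable_funX.
Qed.

(** The positive and negative parts have equal integrals by symmetry; integrability makes them
    finite, so their difference is zero. *)
Lemma normal_integral0 (s : R) (X : {RV P >-> R}) : (s != 0)%R ->
  (forall B : set R, measurable B -> P (X @^-1` B) = normal_prob 0 s B) ->
  P.-integrable setT (fun w => (X w)%:E) -> \int[P]_w (X w)%:E = 0.
Proof.
move=> s0 lawX iX; rewrite integralE.
have -> : \int[P]_w (fun w => (X w)%:E)^\+ w = \int[P]_w (Num.max (X w) 0%R)%:E.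
  by apply: eq_integral => w _; rewrite funeposE -EFin_max.
have En : \int[P]_w (fun w => (X w)%:E)^\- w = \int[P]_w (Num.max (- X w) 0%R)%:E.
  by apply: eq_integral => w _; rewrite funenegE -EFin_max.
have fin : \int[P]_w (fun w => (X w)%:E)^\- w \is a fin_num.
  by apply: integrable_fin_num => //; exact: integrable_funeneg.
rewrite En in fin *.
rewrite (ge0_integral_normal_law s0 lawX (f := fun x => Num.max x 0%R)); first last.
- exact: measurable_maxr.
- by move=> x; rewrite le_max lexx orbT.
rewrite normal_posneg_moment//.
rewrite -(ge0_integral_normal_law s0 lawX (f := fun x => (Num.max (- x) 0)%R)); first last.
- by apply: measurable_maxr => //; exact: measurableT_comp.
- by move=> x; rewrite le_max lexx orbT.
by rewrite subee.
Qed.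

Lemma sqr_integrable_mul (X Y : {RV P >-> R}) :
  P.-integrable setT (fun w => (X w ^+ 2)%:E) ->
  P.-integrable setT (fun w => (Y w ^+ 2)%:E) ->
  P.-integrable setT (fun w => (X w * Y w)%:E).
Proof.
move=> iX iY; apply: (le_integrable _ _ _ (integrableD _ iX iY)) => //.
  by apply/measurable_EFinP; exact: measurable_funM.
move=> w _; rewrite /= lee_fin normrM.
rewrite (ger0_norm (addr_ge0 _ _)) ?sqr_ge0//.
rewrite -[in leRHS](real_normK (num_real (X w))) -[in leRHS](real_normK (num_real (Y w))).
by have := normr_ge0 (X w); have := normr_ge0 (Y w); nra.
Qed.

Lemma sqr_integrable_id (X : {RV P >-> R}) :
  P.-integrable setT (fun w => (X w ^+ 2)%:E) ->
  P.-integrable setT (fun w => (X w)%:E).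
Proof.
move=> iX; have i1 : P.-integrable setT (cst 1%E) by exact: finite_measure_integrable_cst.
apply: (le_integrable _ _ _ (integrableD _ iX i1)) => //.
  exact/measurable_EFinP.
move=> w _; rewrite /= lee_fin.
rewrite [leRHS]ger0_norm ?addr_ge0 ?sqr_ge0// -[in leRHS](real_normK (num_real (X w))).
by have := normr_ge0 (X w); nra.
Qed.

(* The product rule says that the joint law is the product of the marginal
   laws; Fubini then factors out the vanishing mean of [Y]. *)
Lemma indep_integral_mul0 (X Y : {RV P >-> R}) :
  (forall A B : set R, measurable A -> measurable B ->
    P (X @^-1` A `&` Y @^-1` B) = P (X @^-1` A) * P (Y @^-1` B)) ->
  P.-integrable setT (fun w => (Y w)%:E) ->
  P.-integrable setT (fun w => (X w * Y w)%:E) ->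
  \int[P]_w (Y w)%:E = 0 -> \int[P]_w (X w * Y w)%:E = 0.
Proof.
move=> indXY iY iXY Y0.
pose Z w := (X w, Y w).
have mZ : measurable_fun setT Z by exact: measurable_fun_pair.
pose Zp : {mfun T >-> (R * R)%type} := HB.pack Z (isMeasurableFun.Build _ _ _ _ Z mZ).
pose f (z : (R * R)%type) : \bar R := (z.1 * z.2)%R%:E.
have mf : measurable_fun setT f by apply/measurable_EFinP; exact: measurable_funM.
(* Agreement on measurable rectangles determines the product measure. *)
have lawZ A : measurable A -> (distribution P X \x distribution P Y) A = distribution P Zp A.
  by apply: product_measure_unique => B C mB mC; exact: indXY.
have iZ : (distribution P Zp).-integrable setT f by exact: integrable_pushforward.
have iXxY : (distribution P X \x distribution P Y).-integrable setT f.
  apply/integrableP; split => //; case/integrableP : iZ => _.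
  rewrite (@eq_measure_integral _ _ _ _ (distribution P Zp)
    (distribution P X \x distribution P Y))// => A mA _; exact: lawZ.
have -> : \int[P]_w (X w * Y w)%:E = \int[distribution P Zp]_z f z.
  by rewrite [RHS]integral_pushforward.
rewrite -(@eq_measure_integral _ _ _ _ _ (distribution P X \x distribution P Y)%E); last first.
  by move=> A mA _; exact: lawZ.
rewrite -integral12_prod_meas1//; apply: integral0_eq => x _.
have iY' : (distribution P Y).-integrable setT (fun y : R => y%:E).
  by apply: integrable_pushforward => //; exact: EFin_measurable.
rewrite /fubini_F /f /=; under eq_integral do rewrite EFinM.
by rewrite integralZl// integral_pushforward//= Y0 mule0.
Qed.

End normal_variables.

(** * Measurability of the estimators *)

Section measurable_matrices.
Context {R : realType} {d : measure_display} {T : measurableType d}.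

Definition measurable_mx (m n : nat) (F : T -> 'M[R]_(m, n)) :=
  forall i j, measurable_fun setT (fun w => F w i j).

Lemma measurable_mx_cst m n (A : 'M[R]_(m, n)) : measurable_mx (fun=> A).
Proof. by move=> i j; exact: measurable_cst. Qed.

Lemma measurable_mxD m n (F G : T -> 'M[R]_(m, n)) :
  measurable_mx F -> measurable_mx G -> measurable_mx (fun w => F w + G w).
Proof.
move=> mF mG i j; rewrite (_ : (fun _ => _) = fun w => F w i j + G w i j).
  exact: measurable_funD.
by apply/funext => w; rewrite mxE.
Qed.

Lemma measurable_mxZ m n (a : T -> R) (F : T -> 'M[R]_(m, n)) :
  measurable_fun setT a -> measurable_mx F -> measurable_mx (fun w => a w *: F w).
Proof.
move=> ma mF i j; rewrite (_ : (fun _ => _) = fun w => a w * F w i j).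
  exact: measurable_funM.
by apply/funext => w; rewrite mxE.
Qed.

Lemma measurable_mxB m n (F G : T -> 'M[R]_(m, n)) :
  measurable_mx F -> measurable_mx G -> measurable_mx (fun w => F w - G w).
Proof.
move=> mF mG i j; rewrite (_ : (fun _ => _) = fun w => F w i j - G w i j).
  exact: measurable_funB.
by apply/funext => w; rewrite !mxE.
Qed.

Lemma measurable_mulmx m n p (A : 'M[R]_(m, n)) (F : T -> 'M[R]_(n, p)) :
  measurable_mx F -> measurable_mx (fun w => A *m F w).
Proof.
move=> mF i j; rewrite (_ : (fun _ => _) = fun w => \sum_l A i l * F w l j).
  by apply: measurable_sum => l; exact: measurable_funM.
by apply/funext => w; rewrite mxE.
Qed.

Lemma measurable_col_mx0 m n p (F : T -> 'M[R]_(m, p)) :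
  measurable_mx F -> measurable_mx (fun w => col_mx (F w) (0 : 'M[R]_(n, p))).
Proof.
move=> mF i j; case: (fintype.split_ordP i) => l ->.
  by under eq_fun do rewrite col_mxEu; exact: mF.
by under eq_fun do rewrite col_mxEd mxE; exact: measurable_cst.
Qed.

Lemma measurable_enorm m (F : T -> 'cV[R]_m) :
  measurable_mx F -> measurable_fun setT (fun w => enorm (F w)).
Proof.
move=> mF; rewrite /enorm.
apply: (measurableT_comp (continuous_measurable_fun (@sqrt_continuous R))).
by apply: measurable_sum => i; exact: measurable_funX.
Qed.

Lemma measurable_ols n m (Z : 'M[R]_(n, m)) (Y : T -> 'cV[R]_n) :
  measurable_mx Y -> measurable_mx (fun w => ols Z (Y w)).
Proof. by move=> mY; do 2 apply: measurable_mulmx. Qed.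

Lemma measurable_beta_tilde (sigma alpha : R) (k1 k2 n : nat)
    (X : 'M[R]_(n, k1 + k2)) (Y : T -> 'cV[R]_n) :
  measurable_mx Y -> measurable_mx (fun w => beta_tilde sigma alpha X (Y w)).
Proof.
move=> mY.
have mR : measurable_mx (fun w => beta_R X (Y w)).
  exact/measurable_col_mx0/measurable_ols.
have mU : measurable_mx (fun w => beta_U X (Y w)) by exact: measurable_ols.
have ml : measurable_fun setT (fun w => lambda_hat sigma alpha X (Y w)).
  rewrite /lambda_hat; set a := expR (- _).
  (* The weight is a continuous function of its exponent, as the denominator never vanishes; only
     the exponent then has to be shown measurable. *)
  have cinv : continuous (fun z : R => (1 + a * expR z)^-1).
    move=> z; apply: cvgV.
      by rewrite gt_eqF// addr_gt0// mulr_gt0 ?expR_gt0.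
    apply: cvgD; first exact: cvg_cst.
    by apply: cvgM; [exact: cvg_cst|exact: continuous_expR].
  apply: (measurableT_comp (continuous_measurable_fun cinv)).
  apply: measurable_funM => //; apply: measurable_funM => //; apply: measurable_funX.
  by apply: measurable_enorm; apply: measurable_mxB; exact: measurable_mulmx.
apply: measurable_mxD; apply: measurable_mxZ => //.
exact: measurable_funB.
Qed.

Lemma measurable_noise (e : nat -> T -> R) n :
  (forall i, measurable_fun setT (e i)) -> measurable_mx (noise e n).
Proof.
move=> me i j; rewrite (_ : (fun _ => _) = e i)//.
by apply/funext => w; rewrite mxE.
Qed.

End measurable_matrices.

(** * Quadratic forms in uncorrelated noise *)

Section white_noise.
Context {R : realType} {d : measure_display} {T : measurableType d}.
Variables (P : probability T R) (e : nat -> {RV P >-> R}) (s : R).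
Local Open Scope ereal_scope.
Hypothesis int_mul : forall i j, P.-integrable setT (fun w => (e i w * e j w)%:E).
Hypothesis cov : forall i j,
  \int[P]_w (e i w * e j w)%:E = if i == j then s%:E else 0.
Local Notation u := (noise (fun i => e i : T -> R)).

Let integrable_summand n (G : 'M[R]_n) (i j : 'I_n) :
  P.-integrable setT (fun w => (G i j * (u n w i 0 * u n w j 0))%:E).
Proof.
apply: eq_integrable (integrableZl measurableT (G i j) (int_mul i j)) => // w _.
by rewrite !mxE EFinM.
Qed.

Let qform_noiseE n (G : 'M[R]_n) w :
  (qform G (u n w))%:E = \sum_i \sum_j (G i j * (u n w i 0 * u n w j 0))%:E.
Proof. by rewrite qform_sum -sumEFin; apply: eq_bigr => i _; rewrite -sumEFin. Qed.

Lemma integrable_qform_noise n (G : 'M[R]_n) :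
  P.-integrable setT (fun w => (qform G (u n w))%:E).
Proof.
under eq_fun do rewrite qform_noiseE.
by apply: integrable_sum => // i _; exact: integrable_sum.
Qed.

(** Off-diagonal covariances vanish, so only the diagonal of [G] contributes. *)
Lemma integral_qform_noise n (G : 'M[R]_n) :
  \int[P]_w (qform G (u n w))%:E = (s * \tr G)%:E.
Proof.
under eq_integral do rewrite qform_noiseE.
rewrite integral_sum//; last by move=> i; exact: integrable_sum.
rewrite /mxtrace mulr_sumr -sumEFin; apply: eq_bigr => i _.
rewrite integral_sum// (bigD1 i)//= [X in _ + X]big1 ?adde0 => [|j ji].
  under eq_integral do rewrite !mxE EFinM.
  by rewrite integralZl// cov eqxx EFinM muleC.
under eq_integral do rewrite !mxE EFinM.
by rewrite integralZl// cov val_eqE eq_sym (negbTE ji) mule0.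
Qed.

(** Chebyshev's argument: on the event, [M^2 <= F^2 <= a (qform G u + C)]. It is the right-hand
    bound that gets integrated, its mean being known from the trace formula. *)
Lemma markov_qform_noise n (G : 'M[R]_n) (F : T -> R) (a C M : R) :
  (forall v, (0 <= qform G v)%R) -> measurable_fun setT F ->
  (0 <= a)%R -> (0 <= C)%R -> (0 < M)%R ->
  (forall w, (F w ^+ 2 <= a * (qform G (u n w) + C))%R) ->
  P [set w | (M <= F w)%R] <= (a * (s * \tr G + C) / M ^+ 2)%:E.
Proof.
move=> G0 mF a0 C0 M0 hF; pose A := [set w | (M <= F w)%R].
have mA : measurable A.
  rewrite -[A]setTI (_ : A = F @^-1` `[M, +oo[%classic); first exact: mF.
  by apply/seteqP; split => w /=; rewrite in_itv/= andbT.
have iq := integrable_qform_noise G.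
have iqC : P.-integrable setT (fun w => (qform G (u n w))%:E + C%:E).
  by apply: integrableD => //; exact: finite_measure_integrable_cst.
have ibound : P.-integrable setT (fun w => (a * (qform G (u n w) + C))%:E).
  by apply: eq_integrable (integrableZl measurableT a iqC) => // w _; rewrite EFinM EFinD.
have M2 : (0 < M ^+ 2)%R by rewrite exprn_gt0.
rewrite EFinM lee_pdivlMr// muleC.
have -> : (a * (s * \tr G + C))%:E = \int[P]_w (a * (qform G (u n w) + C))%:E.
  under eq_integral do rewrite EFinM EFinD.
  rewrite integralZl// integralD//; last exact: finite_measure_integrable_cst.
  by rewrite integral_qform_noise integral_cst//= probability_setT mule1 EFinM EFinD.
apply: (@le_trans _ _ (\int[P]_(w in A) (a * (qform G (u n w) + C))%:E)).
  rewrite -integral_cst//; apply: ge0_le_integral => //.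
  - by move=> w _; rewrite lee_fin ltW.
  - by apply: measurable_funTS; exact: measurable_int ibound.
  - move=> w Aw; rewrite lee_fin (le_trans _ (hF w))//.
    by rewrite ler_pXn2r// nnegrE ltW// (lt_le_trans M0).
apply: ge0_subset_integral => //.
- exact: measurable_int ibound.
- by move=> w _; rewrite lee_fin mulr_ge0 ?addr_ge0.
Qed.

End white_noise.

Lemma mutually_independent_pair (R : realType) d (T : measurableType d) (P : probability T R)
    (e : nat -> T -> R) i j (A B : set R) :
  mutually_independent P e -> i != j -> measurable A -> measurable B ->
  P (e i @^-1` A `&` e j @^-1` B) = (P (e i @^-1` A) * P (e j @^-1` B))%E.
Proof.
move=> ind ij mA mB.
(* [mutually_independent] expects a set at every index; this family gives [A] at [i] and, as
   [i != j], [B] at [j]. *)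
have := ind [:: i; j] (fun k => if k == i then A else B).
rewrite !big_cons big_nil mule1 eqxx eq_sym (negbTE ij) => <-.
- congr (P _); apply/seteqP; split => w /=.
    by move=> [wA wB] k; rewrite /= !inE => /orP[/eqP ->|/eqP ->]; rewrite ?eqxx// eq_sym (negbTE ij).
  move=> h; split; first by have := h i; rewrite /= !inE eqxx => /(_ isT).
  by have := h j; rewrite /= !inE eqxx orbT eq_sym (negbTE ij) => /(_ isT).
- by rewrite /= inE ij.
- by move=> k; case: ifP.
Qed.

(** * Uniform limits *)

(** A squeeze between 0 and [r]. Nonemptiness of [S i] gives the lower bound, since the supremum of
    the empty set is [-oo]. *)
Lemma nneg_ereal_sup_cvg0 (R : realType) (I J : Type) (F : set_system I) {FF : Filter F}
    (S : I -> set J) (Z : I -> J -> \bar R) (r : I -> R) :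
  (forall i, S i !=set0) -> (forall i j, 0 <= Z i j)%E -> r @ F --> (0 : R) ->
  (\forall i \near F, forall j, S i j -> (Z i j <= (r i)%:E)%E) ->
  (fun i => ereal_sup [set Z i j | j in S i]) @ F --> (0 : \bar R)%E.
Proof.
move=> S0 Z0 r0 Zr.
apply: (@squeeze_cvge _ _ _ _ (cst 0%E) _ (EFin \o r)); last 2 first.
- exact: cvg_cst.
- exact: cvg_comp r0 _.
near=> i; apply/andP; split.
  have [j Sj] := S0 i; apply: (le_trans (Z0 i j)); apply: ereal_sup_ubound.
  by exists j.
by apply: ge_ereal_sup => _ [j Sj <-]; have : forall j, S i j -> (Z i j <= (r i)%:E)%E; [near: i|exact].
Unshelve. all: by end_near. Qed.

Section tail_bound_limits.
Context {R : realType} {d : measure_display} {T : measurableType d}.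
Variables (P : probability T R) (V : pointedType) (k : nat) (K : R).
Variable D : nat -> V -> T -> R.
Hypothesis K0 : 0 <= K.
Hypothesis tailD : forall n b M, (k <= n)%N -> 0 < M ->
  (P [set w | M <= Num.sqrt n%:R * D n b w]%R <= (K / M ^+ 2)%:E)%E.

Lemma sup_tail_cvg0 :
  (fun M : R => ereal_sup [set P [set w | M <= Num.sqrt nb.1%:R * D nb.1 nb.2 w]
                          | nb in [set nb : nat * V | (k <= nb.1)%N]]) @ +oo --> 0%E.
Proof.
(* The simpler majorant [K / M] dominates [K / M^2] as soon as [M >= 1]. *)
apply: (@nneg_ereal_sup_cvg0 _ _ _ _ _ (fun=> _) _ (fun M => K * M^-1)).
- by move=> _; exists (k, point) => /=.
- by [].
- rewrite -[0](mulr0 K); apply: cvgM; first exact: cvg_cst.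
  apply/cvgr0Pnorm_le => del del0; near=> M.
  have M0 : del^-1 <= M by near: M; apply: nbhs_pinfty_ge; exact: num_real.
  have dV : 0 < del^-1 by rewrite invr_gt0.
  by rewrite ger0_norm ?invr_ge0 ?(le_trans (ltW dV))// -[del]invrK lef_pV2 ?posrE// (lt_le_trans dV).
near=> M => -[n b]/= kn.
have M1 : 1 <= M by near: M; apply: nbhs_pinfty_ge; exact: num_real.
have M0 : 0 < M by exact: lt_le_trans M1.
rewrite (le_trans (tailD b kn M0))// lee_fin ler_wpM2l// lef_pV2 ?posrE ?exprn_gt0//.
by rewrite expr2 ler_peMr// ltW.
Unshelve. all: by end_near. Qed.

Lemma sup_tail_littleo_cvg0 (eps : R) (c : nat -> R) : 0 < eps -> (forall n, 0 <= c n) ->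
  c =o_\oo (fun n : nat => Num.sqrt n%:R) ->
  (fun n : nat => ereal_sup [set P [set w | eps <= c n * D n b w] | b in [set: V]])
    @ \oo --> 0%E.
Proof.
move=> eps0 c0 co.
apply: (@nneg_ereal_sup_cvg0 _ _ _ _ _ (fun=> _) _
  (fun n => K / eps ^+ 2 * (c n / Num.sqrt n%:R) ^+ 2)).
- by move=> _; exists point.
- by [].
- rewrite -[X in _ --> X](mulr0 (K / eps ^+ 2)); apply: cvgM; first exact: cvg_cst.
  rewrite -[X in _ --> X](mulr0 0).
  have h : (fun n => c n / Num.sqrt n%:R) @ \oo --> (0 : R).
    apply/cvgr0Pnorm_le => del del0; have /eqoP/(_ _ del0) := co.
    apply: filterS2 (nbhs_infty_gt 0) => n n0.
    by rewrite normrM normfV ler_pdivrMr// normr_gt0 gt_eqF// sqrtr_gt0 ltr0n.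
  exact: cvgM.
near=> n => b _ /=.
have n0 : (0 < n)%N by near: n; exact: nbhs_infty_gt.
have kn : (k <= n)%N by near: n; exact: nbhs_infty_ge.
have sn : 0 < Num.sqrt n%:R :> R by rewrite sqrtr_gt0 ltr0n.
(* If [c n = 0] the event is empty because [eps > 0]; otherwise it is the tail event at level
   [M = eps sqrt n / c n], of probability at most [K (c n / sqrt n)^2 / eps^2]. *)
have [cn|cn] := eqVneq (c n) 0.
  rewrite [X in P X](_ : _ = set0) ?measure0 ?lee_fin ?cn ?mul0r ?expr0n ?mulr0//.
  by apply/seteqP; split => w //=; rewrite mul0r leNgt eps0.
have cn0 : 0 < c n by rewrite lt_neqAle eq_sym cn c0.
have M0 : 0 < eps * Num.sqrt n%:R / c n by rewrite divr_gt0 ?mulr_gt0.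
rewrite (_ : [set w | _] = [set w | eps * Num.sqrt n%:R / c n <= Num.sqrt n%:R * D n b w]).
  apply: (le_trans (tailD b kn M0)); rewrite lee_fin le_eqVlt; apply/orP; left; apply/eqP.
  by field; rewrite !gt_eqF.
apply/funext => w /=.
by rewrite ler_pdivrMr// [eps * _]mulrC -mulrA ler_pM2l// [_ * c n]mulrC.
Unshelve. all: by end_near. Qed.

End tail_bound_limits.

(** * Uniform root-n consistency of the averaged estimator *)

Theorem theorem5 (R : realType) (k1 k2 : nat) (hk1 : (1 <= k1)%N) (hk2 : (1 <= k2)%N)
  (X : forall n : nat, 'M[R]_(n, k1 + k2))
  (hrank : forall n : nat, (k1 + k2 <= n)%N -> \rank (X n) = (k1 + k2)%N)
  (Q : 'M[R]_(k1 + k2))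
  (hlim : (fun n : nat => (n%:R)^-1 *: ((X n)^T *m X n)) @ \oo --> Q)
  (hQ : posdef Q)
  (sigma : R) (hsigma : 0 < sigma) (alpha : R) (halpha : 0 < alpha)
  (d : measure_display) (T : measurableType d) (P : probability T R)
  (e : nat -> {RV P >-> R})
  (hind : mutually_independent P (fun i => (e i : T -> R)))
  (hnorm : forall (i : nat) (B : set R), measurable B ->
             P (e i @^-1` B) = normal_prob 0 sigma B) :
  let Y := fun (n : nat) (b : 'cV[R]_(k1 + k2)) (w : T) =>
             X n *m b + noise (fun i => (e i : T -> R)) n w in
  let bt := fun (n : nat) (b : 'cV[R]_(k1 + k2)) (w : T) =>
             beta_tilde sigma alpha (X n) (Y n b w) in
  (* (1) *)
  ((fun M : R => ereal_sup [set P [set w | M <= Num.sqrt nb.1%:R * enorm (bt nb.1 nb.2 w - nb.2)]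
                            | nb in [set nb : nat * 'cV[R]_(k1 + k2) | (k1 + k2 <= nb.1)%N]]) @ +oo --> 0%E
   /\ forall (eps : R) (c : nat -> R), 0 < eps -> (forall n, 0 <= c n) ->
        c =o_\oo (fun n : nat => Num.sqrt n%:R) ->
        (fun n : nat => ereal_sup [set P [set w | eps <= c n * enorm (bt n b w - b)]
                                   | b in [set: 'cV[R]_(k1 + k2)]]) @ \oo --> 0%E)
  /\
  (* (2) *)
  (forall (p : nat -> nat) (A : forall n : nat, 'M[R]_(p n, k1 + k2)),
     (exists B : R, forall (n : nat) (a : R),
         eigenvalue ((A n)^T *m A n) a -> a <= B) ->
     (fun M : R => ereal_sup [set P [set w | M <= Num.sqrt nb.1%:R *
                                     enorm (A nb.1 *m bt nb.1 nb.2 w - A nb.1 *m nb.2)]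
                            | nb in [set nb : nat * 'cV[R]_(k1 + k2) | (k1 + k2 <= nb.1)%N]]) @ +oo --> 0%E
     /\ forall (eps : R) (c : nat -> R), 0 < eps -> (forall n, 0 <= c n) ->
          c =o_\oo (fun n : nat => Num.sqrt n%:R) ->
          (fun n : nat => ereal_sup [set P [set w | eps <= c n *
                                       enorm (A n *m bt n b w - A n *m b)]
                                     | b in [set: 'cV[R]_(k1 + k2)]]) @ \oo --> 0%E).
Proof.
move=> Y bt; set k := (k1 + k2)%N in X hrank Q hlim hQ Y bt *.
have k0 : (0 < k)%N by rewrite addn_gt0 hk1.
have s0 : sigma != 0 by rewrite gt_eqF.
have [c c0 hc] := gram_coercive k0 hrank hlim hQ.
have uX n : (k <= n)%N -> (X n)^T *m X n \in unitmx.
  by move=> kn; apply/posdef_unitmx/posdef_gram/hrank.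
have isqr i := normal_sqr_integrable s0 (hnorm i).
have iid i := sqr_integrable_id (isqr i).
have imul i j := sqr_integrable_mul (isqr i) (isqr j).
(* The common second moment of the errors, kept as an unevaluated finite number; [sE] transfers it
   to every index because the laws coincide. *)
pose s := fine (\int[P]_w (e 0%N w ^+ 2)%:E)%E.
have sE i : (\int[P]_w (e i w ^+ 2)%:E)%E = s%:E.
  rewrite fineK; last exact: integrable_fin_num.
  have msqr : measurable_fun setT (fun x : R => x ^+ 2) by exact: measurable_funX.
  by rewrite !(ge0_integral_normal_law s0 (hnorm _) (f := fun x => x ^+ 2))// => x; exact: sqr_ge0.
have s_ge0 : 0 <= s.
  by rewrite fine_ge0// integral_ge0// => w _; rewrite lee_fin sqr_ge0.
have cov i j : (\int[P]_w (e i w * e j w)%:E)%E = if i == j then s%:E else 0%E.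
  case: eqVneq => [->|ij]; first exact: sE.
  apply: indep_integral_mul0 => //; last exact: normal_integral0 s0 (hnorm j) (iid j).
  by move=> A B mA mB; exact: (mutually_independent_pair hind ij).
pose C := sigma ^+ 2 / alpha * expR (2 * alpha * k2%:R).
have C0 : 0 <= C by rewrite mulr_ge0 ?expR_ge0// divr_ge0 ?sqr_ge0// ltW.
have mbt n b i j : measurable_fun setT (fun w => bt n b w i j).
  apply: measurable_beta_tilde; apply: measurable_mxD; first exact: measurable_mx_cst.
  by apply: measurable_noise.
(* In the constant, [B] compares [D^2] with the squared error, [1 / c] comes from Gram coercivity, 2
   from the square of a sum, [s k] from the mean of the projected noise, and [C] from the weight. *)
have tail (D : nat -> 'cV[R]_k -> T -> R) (B : R) : 0 <= B ->
    (forall n b, measurable_fun setT (D n b)) ->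
    (forall n b w, D n b w ^+ 2 <= B * enorm (bt n b w - b) ^+ 2) ->
    forall n b M, (k <= n)%N -> 0 < M ->
    (P [set w | M <= Num.sqrt n%:R * D n b w]%R
      <= ((B / c * 2) * (s * k%:R + C) / M ^+ 2)%:E)%E.
  move=> B0 mD hD n b M kn M0.
  (* Reading [k] as the trace of the hat matrix puts the bound in the form of
     [markov_qform_noise]. *)
  rewrite -(trace_hat_mx (uX n kn)).
  apply: (markov_qform_noise imul cov) => //.
  - by move=> v; rewrite -enorm_hat_mx ?sqr_ge0// uX.
  - exact: measurable_funM.
  - by rewrite mulr_ge0// divr_ge0// ltW.
  - move=> w; rewrite exprMn sqr_sqrtr ?ler0n//.
    rewrite (le_trans (ler_wpM2l (ler0n _ _) (hD n b w)))// mulrCA -!mulrA ler_wpM2l//.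
    rewrite ler_pdivlMl//.
    by rewrite (le_trans (hc _ _ kn))// mulrDr enorm_beta_tilde_le// uX.
(* Both parts of the theorem are instances: [D] is the norm of the error, or of its image under
   [A n]. *)
have lim (D : nat -> 'cV[R]_k -> T -> R) (B : R) : 0 <= B ->
    (forall n b, measurable_fun setT (D n b)) ->
    (forall n b w, D n b w ^+ 2 <= B * enorm (bt n b w - b) ^+ 2) ->
    ((fun M : R => ereal_sup [set P [set w | M <= Num.sqrt nb.1%:R * D nb.1 nb.2 w]
        | nb in [set nb : nat * 'cV[R]_k | (k <= nb.1)%N]]) @ +oo --> 0%E
     /\ forall (eps : R) (c : nat -> R), 0 < eps -> (forall n, 0 <= c n) ->
        c =o_\oo (fun n : nat => Num.sqrt n%:R) ->
        (fun n : nat => ereal_sup [set P [set w | eps <= c n * D n b w]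
          | b in [set: 'cV[R]_k]]) @ \oo --> 0%E).
  move=> B0 mD hD.
  have K0 : 0 <= (B / c * 2) * (s * k%:R + C).
    have Bc : 0 <= B / c by rewrite divr_ge0// ltW.
    by apply: mulr_ge0; [exact: mulr_ge0|apply: addr_ge0 => //; exact: mulr_ge0].
  split; first exact: sup_tail_cvg0 K0 (tail D B B0 mD hD).
  by move=> eps c'; exact: sup_tail_littleo_cvg0 (tail D B B0 mD hD) eps c'.
split.
  apply: (lim (fun n b w => enorm (bt n b w - b)) 1) => // [n b|n b w].
    apply: measurable_enorm; apply: measurable_mxB; first exact: mbt.
    exact: measurable_mx_cst.
  by rewrite mul1r.
move=> p A [B hB].
(* [lim] asks for a nonnegative constant; the maximum with 0 still bounds the eigenvalues. *)
apply: (lim (fun n b w => enorm (A n *m bt n b w - A n *m b)) (Num.max B 0)) => [|n b|n b w].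
- by rewrite le_max lexx orbT.
- apply: measurable_enorm; apply: measurable_mxB; last exact: measurable_mx_cst.
  by apply: measurable_mulmx; exact: mbt.
- rewrite -mulmxBr; apply: enorm_mulmx_eigenvalue_le => a /hB aB.
  by rewrite le_max aB.
Qed.
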